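(* Let $\mathbb{A}=(A_1,\dots,A_n)\in\mathbb{P}_m^n$ and $\omega=(w_1,\dots,w_n)\in\Delta_n$. Let $0 < t \leq z < 1$. If $\mathcal{R}_{t,z}(\omega; \mathbb{A}) \leq I$ then $$\mathcal{R}_{t,z}(\omega; \mathbb{A}) \leq \mathcal{Q}_{\frac{1}{p}}(\omega; \mathbb{A}^{1-t}) = \left( \sum_{j=1}^{n} w_{j} A_{j}^{\frac{1-t}{p}} \right)^{p}$$ for all $p$ such that $p \leq z$.
   Context: $\mathbb{P}_m$ is the set of $m\times m$ complex Hermitian positive definite matrices; $\le$ is the Loewner order ($A\ge B$ iff $A-B$ is positive semidefinite); $I$ is the identity matrix. $\Delta_n$ is the set of positive probability vectors $\omega=(w_1,\dots,w_n)$, i.e. $w_j>0$ and $\sum_j w_j=1$. For $0<t\le z<1$, the Rényi power mean $\mathcal{R}_{t,z}(\omega;\mathbb{A})$ is the unique $X\in\mathbb{P}_m$ satisfying $X=\sum_{j=1}^n w_j\left(A_j^{\frac{1-t}{2z}}X^{\frac{t}{z}}A_j^{\frac{1-t}{2z}}\right)^z$ (existence and uniqueness are known). For real $r\neq 0$, the quasi-arithmetic mean of order $r$ is $\mathcal{Q}_r(\omega;\mathbb{A})=\left(\sum_{j=1}^n w_jA_j^r\right)^{1/r}$, and $\mathbb{A}^{1-t}=(A_1^{1-t},\dots,A_n^{1-t})$.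
   Formalization: The claim is proved for 0 < p ≤ z rather than all p ≤ z: at p = 0 the order 1/p is undefined, and for p < 0 the inequality fails (e.g. m = 1, t = z = 1/2, equal weights, A = (1/4, 9/4), p = -1 gives 1 ≤ 3/4). *)

(* Defs.v *)
From mathcomp Require Import all_boot all_order all_algebra.
From mathcomp Require Import sesquilinear spectral.
From mathcomp Require Import complex.
From mathcomp Require Import reals exp.

Set Implicit Arguments.
Unset Strict Implicit.
Unset Printing Implicit Defensive.

Import Order.TTheory GRing.Theory Num.Theory.
Local Open Scope ring_scope.
Local Open Scope complex_scope.
Local Open Scope sesquilinear_scope.

Definition psdmx (R : realType) (m : nat) (A : 'M[R[i]]_m) : Prop :=
  A \is hermsymmx /\ forall x : 'cV[R[i]]_m, 0 <= (x^t* *m A *m x) 0 0.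

Definition posdefmx (R : realType) (m : nat) (A : 'M[R[i]]_m) : Prop :=
  A \is hermsymmx /\
  forall x : 'cV[R[i]]_m, x != 0 -> 0 < (x^t* *m A *m x) 0 0.

Definition loewner_le (R : realType) (m : nat) (A B : 'M[R[i]]_m) : Prop :=
  psdmx (B - A).

(* Functional calculus for a ↦ a ^ r: for Hermitian A, spectralmx A is unitary
   and diagonalizes A, and the entries of spectral_diag A are the (real)
   eigenvalues. Only meaningful when A is positive definite. *)
Definition mxpowR (R : realType) (m : nat) (A : 'M[R[i]]_m) (r : R)
    : 'M[R[i]]_m :=
  invmx (spectralmx A)
  *m diag_mx (map_mx (fun a : R[i] => (complex.Re a `^ r)%:C) (spectral_diag A))
  *m spectralmx A.

Definition pos_prob_vector (R : realType) (n : nat) (w : 'I_n -> R) : Prop :=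
  (forall j, 0 < w j) /\ \sum_(j < n) w j = 1.

(* X is the Rényi power mean of A with weight w: for 0 < t <= z < 1 and A
   positive definite this fixed-point equation has exactly one positive
   definite solution, so X is determined by the predicate. *)
Definition is_renyi_power_mean (R : realType) (n m : nat) (t z : R)
    (w : 'I_n -> R) (A : 'I_n -> 'M[R[i]]_m) (X : 'M[R[i]]_m) : Prop :=
  posdefmx X /\
  X = \sum_(j < n) (w j)%:C *:
        mxpowR (mxpowR (A j) ((1 - t) / (2 * z))
                *m mxpowR X (t / z)
                *m mxpowR (A j) ((1 - t) / (2 * z))) z.

Definition quasi_arith_mean (R : realType) (n m : nat) (r : R)
    (w : 'I_n -> R) (A : 'I_n -> 'M[R[i]]_m) : 'M[R[i]]_m :=
  mxpowR (\sum_(j < n) (w j)%:C *: mxpowR (A j) r) (1 / r).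

(* Main.v *)
Require Import Defs.
From mathcomp Require Import all_boot all_order all_algebra.
From mathcomp Require Import complex.
From mathcomp Require Import reals.
From mathcomp Require Import sesquilinear spectral ring lra.
From mathcomp Require Import all_classical topology normedtype sequences exp.
Import Order.TTheory GRing.Theory Num.Theory.
Import numFieldNormedType.Exports.
Set Implicit Arguments.
Unset Strict Implicit.
Local Open Scope ring_scope.
Local Open Scope complex_scope.
Local Open Scope sesquilinear_scope.

(** Two facts about the power function on positive definite matrices, for an
    exponent in [0, 1], carry the proof: it is monotone and it is concave in the
    Loewner order. Since X <= I, monotonicity with exponent t / z gives
    X ^ (t/z) <= I; conjugating by A_j ^ ((1-t)/(2z)) and applying monotonicity
    with exponent z bounds the j-th term of the fixed-point equation by
    A_j ^ (1-t). Hence X is at most the sum of the w_j A_j ^ (1-t), that is, of the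
    w_j (A_j ^ ((1-t)/p)) ^ p, and concavity of the p-th power bounds this by
    (sum of the w_j A_j ^ ((1-t)/p)) ^ p.

    Both facts are instances of one statement, [loewner_power_mean]: if the sum of
    the w_j A_j is at most B, then the sum of the w_j A_j ^ p is at most B ^ p.
    Instead of an integral representation of the power function, the proof shows
    that, for fixed A_j and B, the set of exponents p for which the conclusion
    holds contains 0 and 1, is stable under midpoints
    ([loewner_power_midpoint]) and, by continuity of the quadratic forms in p,
    contains [0, 1] ([midpoint_closed_ge0]). The midpoint step rests on the
    positivity of the block matrix with diagonal A^p, A^q and off-diagonal
    A^((p+q)/2) ([mxform_powR_mean]), which survives averaging.

    Everything is expressed through unitary diagonalizations; real powers can be
    computed in any of them ([mxpowR_udiagR]). *)

(** * Sesquilinear forms, unitary diagonalization and real powers *)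

Section Forms.
Variables (R : realType) (m : nat).
Implicit Types (M N U V : 'M[R[i]]_m) (x y : 'cV[R[i]]_m) (d e : 'I_m -> R).

Lemma hermsymmxP M : reflect (M^t* = M) (M \is hermsymmx).
Proof.
by apply: (iffP (is_hermitianmxP _ _ _)); rewrite expr0 scale1r => /esym.
Qed.

Lemma adjmxM (a b c : nat) (M : 'M[R[i]]_(a, b)) (N : 'M[R[i]]_(b, c)) :
  (M *m N)^t* = N^t* *m M^t*.
Proof. by rewrite trmx_mul map_mxM. Qed.

Lemma adjmxB (a b : nat) (M N : 'M[R[i]]_(a, b)) : (M - N)^t* = M^t* - N^t*.
Proof. by apply/matrixP => i j; rewrite !mxE rmorphB. Qed.

Definition mxform x M y : R[i] := (x^t* *m M *m y) 0 0.

Lemma mxformD x M N y : mxform x (M + N) y = mxform x M y + mxform x N y.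
Proof. by rewrite /mxform mulmxDr mulmxDl mxE. Qed.

Lemma mxformB x M N y : mxform x (M - N) y = mxform x M y - mxform x N y.
Proof. by rewrite /mxform mulmxBr mulmxBl !mxE. Qed.

Lemma mxformZ x a M y : mxform x (a *: M) y = a * mxform x M y.
Proof. by rewrite /mxform -scalemxAr -scalemxAl mxE. Qed.

Lemma mxform_sum n x (F : 'I_n -> 'M[R[i]]_m) y :
  mxform x (\sum_j F j) y = \sum_j mxform x (F j) y.
Proof. by rewrite /mxform mulmx_sumr mulmx_suml summxE. Qed.

Lemma mxformMl x M N y : M \is hermsymmx ->
  mxform x (M *m N) y = mxform (M *m x) N y.
Proof. by move=> /hermsymmxP hM; rewrite /mxform adjmxM hM !mulmxA. Qed.

Lemma mxformMr x M N y : mxform x (M *m N) y = mxform x M (N *m y).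
Proof. by rewrite /mxform !mulmxA. Qed.

Lemma mxform_conj x M y : M \is hermsymmx ->
  mxform y M x = Num.conj (mxform x M y).
Proof.
move=> /hermsymmxP hM; rewrite /mxform.
have <- : (x^t* *m M *m y)^t* = y^t* *m M *m x.
  by rewrite !adjmxM hM trmxCK mulmxA.
by rewrite !mxE.
Qed.

Definition udiag U (r : 'rV[R[i]]_m) : 'M[R[i]]_m := U^t* *m diag_mx r *m U.

(** Every Hermitian matrix has this form with U unitary, so that statements about functions of
    a Hermitian matrix become entrywise statements about a real family. *)
Definition udiagR U d : 'M[R[i]]_m := udiag U (\row_i (d i)%:C).

Lemma conj_realC (a : R) : Num.conj (a%:C) = a%:C.
Proof. exact: conjc_real. Qed.

Lemma udiagR_herm U d : udiagR U d \is hermsymmx.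
Proof.
apply/hermsymmxP; rewrite /udiagR /udiag !adjmxM trmxCK mulmxA; congr (_ *m _ *m _).
apply/matrixP => i j; rewrite !mxE eq_sym; case: eqP => [->|_].
  by rewrite !mulr1n; exact: conj_realC.
by rewrite !mulr0n rmorph0.
Qed.

Lemma unitaryVl U : U \is unitarymx -> U^t* *m U = 1%:M.
Proof. by move=> hU; rewrite -invmx_unitary// mulVmx// unitarymx_unit. Qed.

Lemma unitaryVr U : U \is unitarymx -> U *m U^t* = 1%:M.
Proof. by move=> hU; apply/unitarymxP. Qed.

Lemma udiagM U (r s : 'rV[R[i]]_m) : U \is unitarymx ->
  udiag U r *m udiag U s = udiag U (\row_i (r 0 i * s 0 i)).
Proof.
move=> hU; rewrite /udiag !mulmxA (mulmxtVK _ hU).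
by rewrite -(mulmxA (U^t*) (diag_mx _)) mulmx_diag.
Qed.

Lemma udiagR_mul U d e : U \is unitarymx ->
  udiagR U d *m udiagR U e = udiagR U (fun i => d i * e i).
Proof.
move=> hU; rewrite /udiagR (udiagM _ _ hU); congr udiag; apply/rowP => i.
by rewrite !mxE rmorphM.
Qed.

Lemma udiagR_one U : U \is unitarymx -> udiagR U (fun=> 1) = 1%:M.
Proof.
move=> hU; rewrite /udiagR /udiag.
have -> : (\row_(i < m) 1%:C) = const_mx (1 : R[i]) by apply/rowP => i; rewrite !mxE.
by rewrite diag_const_mx mulmx1 (unitaryVl hU).
Qed.

Lemma eq_udiagR U d e : d =1 e -> udiagR U d = udiagR U e.
Proof.
by move=> de; rewrite /udiagR; congr udiag; apply/rowP => i; rewrite !mxE de.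
Qed.

(** Positivity of a diagonalized matrix is visible here: its form is a
    combination of squared moduli with the eigenvalues as coefficients. *)
Lemma udiagR_form U d x :
  mxform x (udiagR U d) x = \sum_i (d i)%:C * `|(U *m x) i 0| ^+ 2.
Proof.
rewrite /mxform /udiagR !mulmxA -adjmxM -mulmxA mxE; apply: eq_bigr => i _.
rewrite mul_mx_diag !mxE normCK; ring.
Qed.

Lemma udiagR_psd U d : (forall i, 0 <= d i) -> psdmx (udiagR U d).
Proof.
move=> d0; split=> [|x]; first exact: udiagR_herm.
rewrite -[X in 0 <= X]/(mxform x (udiagR U d) x) udiagR_form sumr_ge0// => i _.
by rewrite mulr_ge0// ?ler0c ?exprn_ge0.
Qed.

Lemma udiagR_posdef U d : U \is unitarymx -> (forall i, 0 < d i) ->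
  posdefmx (udiagR U d).
Proof.
move=> hU d0; split=> [|x x0]; first exact: udiagR_herm.
rewrite -[X in 0 < X]/(mxform x (udiagR U d) x) udiagR_form.
have p i : 0 <= (d i)%:C * `|(U *m x) i 0| ^+ 2.
  by rewrite mulr_ge0// ?ler0c ?exprn_ge0// ltW.
rewrite lt_def sumr_ge0// andbT; apply: contra x0 => /eqP /psumr_eq0P h.
suff: U *m x == 0 by move=> /eqP e; rewrite -[x]mul1mx -(unitaryVl hU) -mulmxA e mulmx0.
apply/eqP/colP => i; rewrite [RHS]mxE.
have /eqP := h (fun i _ => p i) i erefl.
by rewrite mulf_eq0 expf_eq0/= normr_eq0 fmorph_eq0 gt_eqF// => /eqP.
Qed.

Definition eigvec U i : 'cV[R[i]]_m := U^t* *m delta_mx i 0.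

Lemma udiagR_eigvec U d i : U \is unitarymx ->
  udiagR U d *m eigvec U i = (d i)%:C *: eigvec U i.
Proof.
move=> hU; rewrite /udiagR /udiag /eigvec mulmxA (mulmxtVK _ hU).
rewrite -mulmxA scalemxAr; congr (_ *m _).
apply/colP => j; rewrite mul_diag_mx !mxE; case: (eqVneq j i) => [->//|]; rewrite !mulr0//.
Qed.

Lemma eigvec_neq0 U i : U \is unitarymx -> eigvec U i != 0.
Proof.
move=> hU; apply/eqP => /(congr1 (mulmx U)); rewrite mulmx0 mulmxA (unitaryVr hU) mul1mx.
by move=> /colP/(_ i); rewrite !mxE !eqxx => /eqP; rewrite oner_eq0.
Qed.

Lemma spectral_udiagR M : M \is hermsymmx ->
  M = udiagR (spectralmx M) (fun i => complex.Re (spectral_diag M 0 i)).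
Proof.
move=> hM; have /orthomx_spectralP {1}-> := hermitian_normalmx hM.
rewrite (invmx_unitary (spectral_unitarymx M)) -/(udiag _ _); congr udiag.
apply/rowP => i; rewrite !mxE RRe_real//.
by have /mxOverP := hermitian_spectral_diag_real hM; apply.
Qed.

Lemma herm_udiagR M : M \is hermsymmx ->
  exists2 U, U \is unitarymx & exists d, M = udiagR U d.
Proof.
move=> /spectral_udiagR E; exists (spectralmx M); first exact: spectral_unitarymx.
by exists (fun i => complex.Re (spectral_diag M 0 i)).
Qed.

(** Turns a Loewner inequality into a statement about single eigenvectors, which
    is where the midpoint argument below operates. *)
Lemma psdmx_eigen M : M \is hermsymmx ->
  (forall (a : R) x, x != 0 -> M *m x = a%:C *: x -> 0 <= a) -> psdmx M.
Proof.
move=> /herm_udiagR[U hU [d ->]] h; apply: udiagR_psd => i.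
exact: (h _ (eigvec U i) (eigvec_neq0 i hU) (udiagR_eigvec d i hU)).
Qed.

Lemma posdef_udiagR M : posdefmx M ->
  exists2 U, U \is unitarymx & exists2 d, (forall i, 0 < d i) & M = udiagR U d.
Proof.
move=> [/herm_udiagR[U hU [d ->]]] h; exists U => //; exists d => // i.
have := h _ (eigvec_neq0 i hU).
rewrite -mulmxA udiagR_eigvec// -scalemxAr mxE /eigvec adjmxM trmxCK mulmxA.
rewrite (mulmxtVK _ hU).
have -> : ((delta_mx i 0)^t* *m delta_mx i 0 : 'M[R[i]]_1) 0 0 = 1.
  rewrite mxE (bigD1 i)//= big1 => [|j /negbTE ji]; rewrite !mxE ?ji /= ?mulr0//.
  by rewrite !eqxx rmorph1 mulr1 addr0.
by rewrite mulr1 ltcE => /andP[].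
Qed.

(** The entry (i, j) of the intertwining relation says that W i j vanishes or that
    the eigenvalues d i and e j agree; both survive the application of f. *)
Lemma diag_intertwine (f : R -> R) d e (W : 'M[R[i]]_m) :
  diag_mx (\row_i (d i)%:C) *m W = W *m diag_mx (\row_i (e i)%:C) ->
  diag_mx (\row_i (f (d i))%:C) *m W = W *m diag_mx (\row_i (f (e i))%:C).
Proof.
move=> /matrixP h; apply/matrixP => i j; have := h i j.
rewrite !mul_diag_mx !mul_mx_diag !mxE.
have [->|w0] := eqVneq (W i j) 0; first by rewrite !mulr0 !mul0r.
by rewrite [LHS]mulrC => /(mulfI w0)/complexI ->; exact: mulrC.
Qed.

(** Independence of the functional calculus from the chosen diagonalization: two
    unitary diagonalizations differ by an intertwiner of the diagonal parts. *)
Lemma udiagR_fun (f : R -> R) U V d e : U \is unitarymx -> V \is unitarymx ->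
  udiagR U d = udiagR V e -> udiagR U (f \o d) = udiagR V (f \o e).
Proof.
move=> hU hV h.
have W : diag_mx (\row_i (d i)%:C) *m (U *m V^t*) = (U *m V^t*) *m diag_mx (\row_i (e i)%:C).
  move: h => /(congr1 (fun M => U *m M *m V^t*)); rewrite /udiagR /udiag.
  rewrite !mulmxA (unitaryVr hU) mul1mx => ->.
  by rewrite (mulmxtVK _ hV).
have := diag_intertwine f W.
move=> /(congr1 (fun M => U^t* *m M *m V)); rewrite /udiagR /udiag !mulmxA.
by rewrite (unitaryVl hU) mul1mx (mulmxKtV _ hV).
Qed.

(** Frees [mxpowR] from the particular diagonalization in its definition, so that
    the laws of exponents reduce to those of real numbers. *)
Lemma mxpowR_udiagR U d r : U \is unitarymx ->
  mxpowR (udiagR U d) r = udiagR U (fun i => powR (d i) r).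
Proof.
move=> hU; have hS := spectral_unitarymx (udiagR U d).
have eM := esym (spectral_udiagR (udiagR_herm U d)).
rewrite -(udiagR_fun (fun a => powR a r) hS hU eM) /mxpowR (invmx_unitary hS).
rewrite -/(udiag _ _).
by congr udiag; apply/rowP => i; rewrite !mxE.
Qed.

Lemma mxpowR_posdef M r : posdefmx M -> posdefmx (mxpowR M r).
Proof.
move=> /posdef_udiagR[U hU [d d0 ->]]; rewrite (mxpowR_udiagR _ _ hU).
by apply: udiagR_posdef => // i; rewrite powR_gt0.
Qed.

Lemma mxpowR0 M : posdefmx M -> mxpowR M 0 = 1%:M.
Proof.
move=> /posdef_udiagR[U hU [d d0 ->]]; rewrite (mxpowR_udiagR _ _ hU) -(udiagR_one hU).
by apply: eq_udiagR => i; rewrite powRr0.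
Qed.

Lemma mxpowR1 M : posdefmx M -> mxpowR M 1 = M.
Proof.
move=> /posdef_udiagR[U hU [d d0 ->]]; rewrite (mxpowR_udiagR _ _ hU).
by apply: eq_udiagR => i; rewrite powRr1// ltW.
Qed.

Lemma mxpowRD M r s q : posdefmx M -> r + s = q ->
  mxpowR M r *m mxpowR M s = mxpowR M q.
Proof.
move=> /posdef_udiagR[U hU [d d0 ->]] <-.
rewrite !(mxpowR_udiagR _ _ hU) (udiagR_mul _ _ hU).
by apply: eq_udiagR => i; rewrite powRD//; apply/implyP => _; rewrite gt_eqF.
Qed.

Lemma mxpowRM M r s q : posdefmx M -> r * s = q ->
  mxpowR (mxpowR M r) s = mxpowR M q.
Proof.
move=> /posdef_udiagR[U hU [d d0 ->]] <-; rewrite !(mxpowR_udiagR _ _ hU).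
by apply: eq_udiagR => i; rewrite powRrM.
Qed.

Lemma mx1powR r : mxpowR (1%:M : 'M[R[i]]_m) r = 1%:M.
Proof.
have [U hU] : exists U : 'M[R[i]]_m, U \is unitarymx.
  by exists 1%:M; apply/unitarymxP; rewrite trmx1 map_mx1 mul1mx.
rewrite -(udiagR_one hU) (mxpowR_udiagR _ _ hU).
by apply: eq_udiagR => i; rewrite powR1.
Qed.

(** * The Loewner order *)

Lemma hermsymmxB M N : M \is hermsymmx -> N \is hermsymmx -> M - N \is hermsymmx.
Proof.
by move=> /hermsymmxP hM /hermsymmxP hN; apply/hermsymmxP; rewrite linearB/= map_mxB hM hN.
Qed.

Lemma hermsymmx_wsum n (w : 'I_n -> R) (F : 'I_n -> 'M[R[i]]_m) :
  (forall j, F j \is hermsymmx) -> \sum_j (w j)%:C *: F j \is hermsymmx.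
Proof.
move=> hF; apply/hermsymmxP; rewrite linear_sum/= raddf_sum/=; apply: eq_bigr => j _.
by rewrite linearZ/= map_mxZ (hermsymmxP _ (hF j)); congr (_ *: _); exact: conj_realC.
Qed.

Lemma loewnerP M N : M \is hermsymmx -> N \is hermsymmx ->
  (forall x, mxform x M x <= mxform x N x) <-> loewner_le M N.
Proof.
move=> hM hN; split=> [h|[_ h] x]; last by rewrite -subr_ge0 -mxformB; exact: h.
split=> [|x]; first exact: hermsymmxB.
by rewrite -[X in 0 <= X]/(mxform x (N - M) x) mxformB subr_ge0.
Qed.

Lemma loewner_congr M N (C : 'M[R[i]]_m) : C \is hermsymmx ->
  loewner_le M N -> loewner_le (C *m M *m C) (C *m N *m C).
Proof.
move=> hC [hNM h]; rewrite /loewner_le -mulmxBl -mulmxBr; split=> [|x].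
  by apply/hermsymmxP; rewrite !adjmxM (hermsymmxP _ hC) (hermsymmxP _ hNM) mulmxA.
rewrite -[X in 0 <= X]/(mxform x (C *m (N - M) *m C) x) mxformMr mxformMl//.
exact: h.
Qed.

Lemma posdefmx_congr M (C : 'M[R[i]]_m) : C \is hermsymmx -> C \in unitmx ->
  posdefmx M -> posdefmx (C *m M *m C).
Proof.
move=> hC uC [hM h]; split=> [|x x0].
  by apply/hermsymmxP; rewrite !adjmxM (hermsymmxP _ hC) (hermsymmxP _ hM) mulmxA.
rewrite -[X in 0 < X]/(mxform x (C *m M *m C) x) mxformMr mxformMl//.
by apply: h; apply: contra x0 => /eqP/(congr1 (mulmx (invmx C))); rewrite mulmx0 mulKmx// => ->.
Qed.

Lemma posdefmx_wsum n (w : 'I_n -> R) (F : 'I_n -> 'M[R[i]]_m) :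
  pos_prob_vector w -> (forall j, posdefmx (F j)) ->
  posdefmx (\sum_j (w j)%:C *: F j).
Proof.
move=> [w0 w1] hF; split=> [|x x0]; first by apply: hermsymmx_wsum => j; case: (hF j).
rewrite -[X in 0 < X]/(mxform x _ x) mxform_sum.
have p j : 0 < mxform x ((w j)%:C *: F j) x.
  by rewrite mxformZ mulr_gt0 ?ltr0c//; [rewrite ltcE/= eqxx w0 | case: (hF j) => _; exact].
case: n w F w0 w1 hF p => [|n] w F w0 w1 hF p.
  by move: w1 => /eqP; rewrite big_ord0 eq_sym oner_eq0.
rewrite big_ord_recl ltr_wpDr// sumr_ge0// => j _; exact: ltW.
Qed.

Lemma mxpowR_unit M r : posdefmx M -> mxpowR M r \in unitmx.
Proof.
move=> hM; have [u _] := mulmx1_unit (etrans (mxpowRD hM (subrr r)) (mxpowR0 hM)).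
exact: u.
Qed.

Lemma mxpowR_herm M r : posdefmx M -> mxpowR M r \is hermsymmx.
Proof. by move=> /(mxpowR_posdef r) []. Qed.

Lemma loewner_refl M : loewner_le M M.
Proof.
rewrite /loewner_le subrr; split; first by apply/hermsymmxP; rewrite trmx0 map_mx0.
by move=> y; rewrite mulmx0 mul0mx mxE.
Qed.

Lemma loewner_trans M N P : loewner_le M N -> loewner_le N P -> loewner_le M P.
Proof.
move=> [h1 k1] [h2 k2]; rewrite /loewner_le -(subrKA N P (- M)) /=; split=> [|x].
  by apply/hermsymmxP; rewrite linearD/= map_mxD (hermsymmxP _ h1) (hermsymmxP _ h2).
rewrite -[X in 0 <= X]/(mxform x _ x) mxformD addr_ge0//; [exact: k2|exact: k1].
Qed.

Lemma loewner_wsum n (w : 'I_n -> R) (F G : 'I_n -> 'M[R[i]]_m) :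
  (forall j, 0 <= w j) ->
  (forall j, loewner_le (F j) (G j)) ->
  loewner_le (\sum_j (w j)%:C *: F j) (\sum_j (w j)%:C *: G j).
Proof.
move=> w0 h; rewrite /loewner_le -sumrB.
under eq_bigr do rewrite -scalerBr.
split=> [|x]; first by apply: hermsymmx_wsum => j; case: (h j).
rewrite -[X in 0 <= X]/(mxform x _ x) mxform_sum sumr_ge0// => j _.
by rewrite mxformZ mulr_ge0 ?ler0c//; case: (h j) => _; exact.
Qed.

(** Positivity of the squared norm of M ^ (p / 2) x - M ^ (q / 2) y. In block form
    this says that the 2 x 2 block matrix with diagonal M ^ p, M ^ q and
    off-diagonal M ^ ((p + q) / 2) is positive semidefinite. *)
Lemma mxform_powR_mean M p q x y : posdefmx M ->
  mxform x (mxpowR M ((p + q) / 2)) y + mxform y (mxpowR M ((p + q) / 2)) x <=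
  mxform x (mxpowR M p) x + mxform y (mxpowR M q) y.
Proof.
move=> hM.
pose P s := mxpowR M (s / 2).
have hP s : P s \is hermsymmx by exact: mxpowR_herm.
have e2 s s' u v :
    mxform (P s *m u) 1%:M (P s' *m v) = mxform u (mxpowR M ((s + s') / 2)) v.
  rewrite -(mxformMl _ _ _ (hP s)) -mxformMr -mulmxA mul1mx.
  by rewrite (mxpowRD hM (esym (mulrDl s s' 2^-1))).
have e s u v : mxform (P s *m u) 1%:M (P s *m v) = mxform u (mxpowR M s) v.
  by rewrite e2 mulrDl -splitr.
clearbody P.
pose a := P p *m x; pose b := P q *m y.
have : 0 <= mxform (a - b) 1%:M (a - b).
  rewrite /mxform mulmx1 mxE sumr_ge0// => i _.
  by rewrite !mxE mulrC -normCK exprn_ge0.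
have -> : mxform (a - b) 1%:M (a - b) = mxform a 1%:M a + mxform b 1%:M b
   - (mxform a 1%:M b + mxform b 1%:M a).
  rewrite /mxform !mulmx1 adjmxB mulmxBl !mulmxBr.
  set aa := a^t* *m a; set ab := a^t* *m b; set ba := b^t* *m a; set bb := b^t* *m b.
  rewrite !mxE; ring.
by rewrite subr_ge0 /a /b (e p) (e q) (e2 p q) (e2 q p) (addrC q p).
Qed.
End Forms.

(** * Monotonicity and concavity of powers with exponent in [0, 1] *)

Section Mono.
Variables (R : realType) (m n : nat).
Implicit Types (M N : 'M[R[i]]_m) (x y : 'cV[R[i]]_m).

(** With h = (p + q) / 2, H the mean of the A_j ^ h and K = B ^ h, the eigenvalues
    of K ^ (-1/2) (K - H) K ^ (-1/2) are the real a for which H v = (1 - a) K v has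
    a solution v <> 0. Averaging the block positivity of [mxform_powR_mean] and
    using both hypotheses bounds x* H v + v* H x by x* B^p x + v* B^q v for all x.
    The choice x = B ^ ((q - p) / 2) v makes the right-hand side 2 g and the
    left-hand side 2 (1 - a) g, where g = v* B^q v > 0; hence a >= 0. *)
Lemma loewner_power_midpoint (w : 'I_n -> R) (A : 'I_n -> 'M[R[i]]_m) (B : 'M[R[i]]_m) p q :
  (forall j, 0 <= w j) -> (forall j, posdefmx (A j)) -> posdefmx B ->
  loewner_le (\sum_j (w j)%:C *: mxpowR (A j) p) (mxpowR B p) ->
  loewner_le (\sum_j (w j)%:C *: mxpowR (A j) q) (mxpowR B q) ->
  loewner_le (\sum_j (w j)%:C *: mxpowR (A j) ((p + q) / 2)) (mxpowR B ((p + q) / 2)).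
Proof.
move=> w0 hA hB.
have hS r : \sum_j (w j)%:C *: mxpowR (A j) r \is hermsymmx.
  by apply: hermsymmx_wsum => j; exact: (mxpowR_herm r (hA j)).
move=> /(loewnerP (hS p) (mxpowR_herm p hB)) hp /(loewnerP (hS q) (mxpowR_herm q hB)) hq.
set h := (p + q) / 2.
set H := \sum_j _; pose K := mxpowR B h; rewrite -/K.
pose S := mxpowR B (- (h / 2)); pose T := mxpowR B (h / 2).
pose D := mxpowR B ((q - p) / 2).
have [hSh hT hD hK] : [/\ S \is hermsymmx, T \is hermsymmx, D \is hermsymmx & K \is hermsymmx].
  by split; exact: mxpowR_herm.
have TS : T *m S = 1%:M := etrans (mxpowRD hB (subrr _)) (mxpowR0 hB).
have ST : S *m T = 1%:M := etrans (mxpowRD hB (addNr _)) (mxpowR0 hB).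
have KS : K *m S = T by apply: mxpowRD hB _; field.
have DpD : D *m mxpowR B p *m D = mxpowR B q.
  rewrite (mxpowRD (q := (q + p) / 2) hB); last by field.
  by apply: mxpowRD hB _; field.
have DK : D *m K = mxpowR B q by apply: mxpowRD hB _; rewrite /h; field.
have hH : H \is hermsymmx by exact: hS.
have hmean j x y := mxform_powR_mean p q x y (hA j).
rewrite -/h in hmean.
have HE x y : mxform x H y = \sum_j (w j)%:C * mxform x (mxpowR (A j) h) y.
  by rewrite mxform_sum; apply: eq_bigr => j _; rewrite mxformZ.
clearbody H K S T D h.
have hKH : K - H \is hermsymmx by exact: hermsymmxB.
(* Conjugating by T = B ^ (h / 2) undoes the conjugation by S = T ^ -1. *)
suff psdN : psdmx (S *m (K - H) *m S).
  have : loewner_le (S *m H *m S) (S *m K *m S) by rewrite /loewner_le -mulmxBl -mulmxBr.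
  move=> /(loewner_congr hT); rewrite !mulmxA TS !mul1mx.
  by rewrite -!mulmxA ST !mulmx1.
apply: psdmx_eigen => [|a u u0 Nu].
  by apply/hermsymmxP; rewrite !adjmxM (hermsymmxP _ hSh) (hermsymmxP _ hKH) mulmxA.
pose v := S *m u.
have v0 : v != 0.
  by apply: contra u0 => /eqP/(congr1 (mulmx T)); rewrite mulmx0 mulmxA TS mul1mx => ->.
have Hv : H *m v = (1 - a)%:C *: (K *m v).
  have : (K - H) *m v = a%:C *: (K *m v).
    move: Nu => /(congr1 (mulmx T)); rewrite -scalemxAr !mulmxA TS mul1mx -mulmxA -/v => ->.
    by rewrite KS.
  rewrite mulmxBl => /(canRL (subrK _)) e.
  rewrite rmorphB rmorph1 scalerBl scale1r.
  by apply/eqP; rewrite eq_sym subr_eq addrC; apply/eqP.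
(* This x satisfies x* B^p x = v* B^q v and x* K v = v* B^q v. *)
pose x := D *m v.
pose g := mxform v (mxpowR B q) v.
have g0 : 0 < g by case: (mxpowR_posdef q hB) => _; apply.
have xpx : mxform x (mxpowR B p) x = g.
  by rewrite -(mxformMl _ _ _ hD) -mxformMr DpD.
have xHv : mxform x H v = (1 - a)%:C * g.
  rewrite /g -DK mxformMl// -/x /mxform -!mulmxA Hv -!scalemxAr mxE.
  by rewrite !mulmxA.
have vHx : mxform v H x = (1 - a)%:C * g.
  rewrite (mxform_conj _ _ hH) xHv; apply: conj_Creal; apply: realM.
    by apply/complex_realP; exists (1 - a).
  exact/ger0_real/ltW.
have : mxform x H v + mxform v H x <= g + g.
  rewrite -{1}xpx; apply: le_trans (lerD (hp x) (hq v)).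
  rewrite !HE !mxform_sum -!big_split/=; apply: ler_sum => j _.
  rewrite !mxformZ -!mulrDr; apply: ler_wpM2l; first by rewrite ler0c.
  exact: hmean.
rewrite xHv vHx -mulrDl -rmorphD -mulr2n -mulr_natl.
have -> : g + g = 2 * g by ring.
rewrite ler_pM2r// lecE/= => /andP[_].
clear; lra.
Qed.

(** A quadratic form of M ^ p is a generalized exponential sum in p, which gives
    its continuity in the exponent. *)
Lemma mxform_powR M x : posdefmx M -> exists2 d : 'I_m -> R, (forall i, 0 < d i) &
  exists c : 'I_m -> R, forall p, mxform x (mxpowR M p) x = (\sum_i c i * d i `^ p)%:C.
Proof.
move=> /posdef_udiagR[U hU [d d0 ->]]; exists d => //.
exists (fun i => complex.Re (`|(U *m x) i 0| ^+ 2)) => p.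
rewrite (mxpowR_udiagR _ _ hU) udiagR_form rmorph_sum; apply: eq_bigr => i _.
rewrite [RHS]rmorphM [LHS]mulrC; congr (_ * _).
by apply/esym/RRe_real/ger0_real; rewrite exprn_ge0.
Qed.

Lemma continuous_mxform_powR M x : posdefmx M ->
  continuous (fun p : R => complex.Re (mxform x (mxpowR M p) x)).
Proof.
move=> hM; have [d d0 [c e]] := mxform_powR x hM.
have -> : (fun p : R => complex.Re (mxform x (mxpowR M p) x)) =
    (fun p => \sum_i c i * expR (p * ln (d i))).
  apply/funext => p; rewrite e/=; apply: eq_bigr => i _.
  by rewrite /powR gt_eqF.
apply: continuous_big => [|i _ p]; first exact: add_continuous.
apply: cvgMl_tmp.
apply: continuous_cvg; first exact: continuous_expR.
by apply: cvgMr_tmp; exact: cvg_id.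
Qed.

End Mono.

Lemma midpoint_closed_bisection (R : realType) (E : R -> Prop) :
  E 0 -> E 1 -> (forall p q, E p -> E q -> E ((p + q) / 2)) ->
  forall k p, 0 <= p <= 1 -> exists a b, [/\ E a, E b, a <= p <= b & b - a = 2 ^- k].
Proof.
move=> E0 E1 Em; elim=> [|k IH] p hp.
  by exists 0, 1; rewrite expr0 invr1 subr0.
have [a [b [Ea Eb /andP[ap pb] ab]]] := IH p hp.
have e : 2 ^- k = 2 * 2 ^- k.+1 :> R.
  by rewrite exprS invfM mulrA divff ?mul1r// pnatr_eq0.
rewrite e in ab.
case: (leP p ((a + b) / 2)) => hc.
  by exists a, ((a + b) / 2); split=> //; [exact: Em | rewrite ap | lra].
by exists ((a + b) / 2), b; split=> //; [exact: Em | rewrite (ltW hc) | lra].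
Qed.

(** A midpoint-closed set containing 0 and 1 is dense in [0, 1], so a continuous
    function that is nonnegative on it is nonnegative on [0, 1]. *)
Lemma midpoint_closed_ge0 (R : realType) (f : R -> R) (E : R -> Prop) :
  continuous f -> E 0 -> E 1 -> (forall p q, E p -> E q -> E ((p + q) / 2)) ->
  (forall p, E p -> 0 <= f p) ->
  forall p, 0 <= p <= 1 -> 0 <= f p.
Proof.
move=> cf E0 E1 Em Ef p hp; rewrite leNgt; apply/negP => fp.
have /(@nbhs_ballP _ R)[e /= e0 he] : nbhs p (fun y => f y < 0).
  exact: (cvgr_lt (f p) (cf p) _ fp).
have [a [b [Ea _ /andP[ap pb] ab]]] := midpoint_closed_bisection E0 E1 Em (Num.bound e^-1) hp.
have /he : ball p e a.
  rewrite /ball/= ger0_norm ?subr_ge0//.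
  apply: (@le_lt_trans _ _ (b - a)); first by rewrite lerD2r.
  by rewrite ab invf_plt ?posrE ?exprn_gt0//; apply: upper_nthrootP.
by rewrite /= ltNge Ef.
Qed.

Section Main.
Variables (R : realType) (m n : nat).

(** Monotonicity and concavity of the p-th power at once (a one-point weight gives
    the former, B = sum of the w_j A_j the latter). It is trivial for p = 0 and is
    the hypothesis for p = 1; the exponents in between follow by midpoints and
    continuity. *)
Lemma loewner_power_mean (w : 'I_n -> R) (A : 'I_n -> 'M[R[i]]_m) (B : 'M[R[i]]_m) p :
  pos_prob_vector w -> (forall j, posdefmx (A j)) -> posdefmx B ->
  0 <= p <= 1 ->
  loewner_le (\sum_j (w j)%:C *: A j) B ->
  loewner_le (\sum_j (w j)%:C *: mxpowR (A j) p) (mxpowR B p).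
Proof.
move=> [w0 w1] hA hB hp hAB.
have hS r : \sum_j (w j)%:C *: mxpowR (A j) r \is hermsymmx.
  by apply: hermsymmx_wsum => j; exact: (mxpowR_herm r (hA j)).
apply/(loewnerP (hS p) (mxpowR_herm p hB)) => x.
pose E r := loewner_le (\sum_j (w j)%:C *: mxpowR (A j) r) (mxpowR B r).
pose f M r := complex.Re (mxform x (mxpowR M r) x).
have fE M r : posdefmx M -> mxform x (mxpowR M r) x = (f M r)%:C.
  by move=> hM; have [d d0 [c e]] := mxform_powR x hM; rewrite /f e.
pose F r := f B r - \sum_j w j * f (A j) r.
have FE r : mxform x (mxpowR B r) x - mxform x (\sum_j (w j)%:C *: mxpowR (A j) r) x = (F r)%:C.
  rewrite (fE _ _ hB) mxform_sum /F rmorphB rmorph_sum; congr (_ - _); apply: eq_bigr => j _.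
  by rewrite mxformZ (fE _ _ (hA j)) rmorphM.
rewrite -subr_ge0 FE ler0c.
apply: (@midpoint_closed_ge0 R F E) hp.
- move=> r; apply: cvgB; first exact: (@continuous_mxform_powR R m B x hB r).
  move: r; apply: continuous_big => [|j _ r]; first exact: add_continuous.
  by apply: cvgMl_tmp; exact: (@continuous_mxform_powR R m (A j) x (hA j) r).
- rewrite /E (mxpowR0 hB) (eq_bigr (fun j => (w j)%:C *: 1%:M)) => [|j _].
    have -> : \sum_j (w j)%:C *: 1%:M = 1%:M :> 'M[R[i]]_m.
      by rewrite -scaler_suml -rmorph_sum w1 scale1r.
    exact: loewner_refl.
  by rewrite (mxpowR0 (hA j)).
- rewrite /E (mxpowR1 hB) (eq_bigr (fun j => (w j)%:C *: A j)) => [|j _].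
    exact: hAB.
  by rewrite (mxpowR1 (hA j)).
- move=> r s; apply: loewner_power_midpoint => [j| |]; [exact: ltW | exact: hA | exact: hB].
- move=> r /(loewnerP (hS r) (mxpowR_herm r hB))/(_ x).
  by rewrite -subr_ge0 FE ler0c.
Qed.

End Main.

(** * The bound for the Rényi power mean *)

(** The Löwner-Heinz inequality. *)
Lemma loewner_heinz (R : realType) (m : nat) (A B : 'M[R[i]]_m) p :
  posdefmx A -> posdefmx B -> 0 <= p <= 1 ->
  loewner_le A B -> loewner_le (mxpowR A p) (mxpowR B p).
Proof.
move=> hA hB hp hAB.
have hw : pos_prob_vector (fun _ : 'I_1 => 1 : R) by split=> //; rewrite big_ord1.
have := loewner_power_mean hw (fun=> hA) hB hp.
by rewrite !big_ord1 !scale1r; apply.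
Qed.

Lemma posdefmx1 (R : realType) m : posdefmx (1%:M : 'M[R[i]]_m).
Proof.
have [U hU] : exists U : 'M[R[i]]_m, U \is unitarymx.
  by exists 1%:M; apply/unitarymxP; rewrite trmx1 map_mx1 mul1mx.
by rewrite -(udiagR_one hU); apply: udiagR_posdef.
Qed.

Theorem theorem5p1 (R : realType) (n m : nat) (w : 'I_n -> R)
    (A : 'I_n -> 'M[R[i]]_m) (t z : R) (X : 'M[R[i]]_m)
    (hw : pos_prob_vector w)
    (hA : forall j, posdefmx (A j))
    (ht : 0 < t) (htz : t <= z) (hz : z < 1)
    (hX : is_renyi_power_mean t z w A X)
    (hXI : loewner_le X 1%:M) :
  forall p : R, 0 < p -> p <= z ->
    loewner_le X (quasi_arith_mean (1 / p) w (fun j => mxpowR (A j) (1 - t)))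
    /\ quasi_arith_mean (1 / p) w (fun j => mxpowR (A j) (1 - t))
       = mxpowR (\sum_(j < n) (w j)%:C *: mxpowR (A j) ((1 - t) / p)) p.
Proof.
move=> p p0 pz; move: hX hXI hA => [hX XE] hXI hA.
have [z0 tz01 z01 p01] : [/\ 0 < z, 0 <= t / z <= 1, 0 <= z <= 1 & 0 <= p <= 1].
  clear hX XE hXI hA; have z0 : 0 < z by lra.
  split; [exact: z0 | | by rewrite !ltW | by rewrite ltW//=; lra].
  apply/andP; split; first by apply: divr_ge0; exact: ltW.
  by rewrite ler_pdivrMr// mul1r.
have [e1 e2 e3 e4] : [/\ 1 / (1 / p) = p, (1 - t) / z * z = 1 - t,
    (1 - t) / p * p = 1 - t & (1 - t) * (1 / p) = (1 - t) / p].
  clear hX XE hXI hA; have zN0 : z != 0 by rewrite gt_eqF.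
  have pN0 : p != 0 by rewrite gt_eqF.
  by rewrite !div1r invrK !divfK.
set s := (1 - t) / (2 * z).
have e5 : s + s = (1 - t) / z.
  by clear hX XE hXI hA; rewrite /s; field; rewrite gt_eqF.
have QE : quasi_arith_mean (1 / p) w (fun j => mxpowR (A j) (1 - t))
       = mxpowR (\sum_(j < n) (w j)%:C *: mxpowR (A j) ((1 - t) / p)) p.
  have SE : \sum_(j < n) (w j)%:C *: mxpowR (mxpowR (A j) (1 - t)) (1 / p)
          = \sum_(j < n) (w j)%:C *: mxpowR (A j) ((1 - t) / p).
    by apply: eq_bigr => j _; rewrite (mxpowRM (hA j) e4).
  exact: (etrans (congr1 (mxpowR _) e1) (congr1 ((@mxpowR R m)^~ p) SE)).
split; last exact: QE.
rewrite QE XE.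
have XI : loewner_le (mxpowR X (t / z)) 1%:M.
  by rewrite -(mx1powR m (t / z)); apply: loewner_heinz hX (posdefmx1 R m) tz01 hXI.
have step j : loewner_le (mxpowR (mxpowR (A j) s *m mxpowR X (t / z) *m mxpowR (A j) s) z)
                         (mxpowR (mxpowR (A j) ((1 - t) / p)) p).
  have -> : mxpowR (mxpowR (A j) ((1 - t) / p)) p = mxpowR (mxpowR (A j) ((1 - t) / z)) z.
    exact: etrans (mxpowRM (hA j) e3) (esym (mxpowRM (hA j) e2)).
  apply: loewner_heinz z01 _.
  - exact: (posdefmx_congr (mxpowR_herm s (hA j)) (mxpowR_unit s (hA j))
             (mxpowR_posdef (t / z) hX)).
  - exact: (mxpowR_posdef _ (hA j)).
  have <- : mxpowR (A j) s *m 1%:M *m mxpowR (A j) s = mxpowR (A j) ((1 - t) / z).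
    by rewrite mulmx1 (mxpowRD (hA j) e5).
  exact: (loewner_congr (mxpowR_herm s (hA j)) XI).
have w0 j : 0 <= w j by apply: ltW; case: hw.
have hD j : posdefmx (mxpowR (A j) ((1 - t) / p)) := mxpowR_posdef _ (hA j).
apply: loewner_trans (loewner_wsum w0 step) _.
exact: (loewner_power_mean hw hD (posdefmx_wsum hw hD) p01 (loewner_refl _)).
Qed.
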